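(* The $(2,2)$-reducible nilpotent matrix $$\mathsf{N}=\begin{pmatrix}0&1&0&0\\0&0&0&0\\0&0&0&1\\0&0&0&0\end{pmatrix}$$ has the following normal form: $$\begin{aligned}F(x)={}&\mathsf{N}x+\begin{pmatrix}0\\ x_1x_2F_{1,2}^0(x_1,x_2,x_3,x_4)\\0\\ x_1x_2G_{1,2}^0(x_1,x_2,x_3,x_4)\end{pmatrix}+\begin{pmatrix}0\\ x_1x_4F_{1,4}^0(x_1,x_3,x_4)\\0\\ x_1x_4G_{1,4}^0(x_1,x_3,x_4)\end{pmatrix}+\begin{pmatrix}0\\ x_2x_3F_{2,3}^0(x_2,x_3,x_4)\\0\\ x_2x_3G_{2,3}^0(x_2,x_3,x_4)\end{pmatrix}\\ &+\begin{pmatrix}0\\ x_3x_4F_{3,4}^0(x_3,x_4)\\0\\ x_3x_4G_{3,4}^0(x_3,x_4)\end{pmatrix}+\begin{pmatrix}0\\ x_1F_1^0(x_1,x_3)\\0\\ x_1G_1^0(x_1,x_3)\end{pmatrix}+\begin{pmatrix}x_1F_1^1(x_1,x_3)\\ x_2F_1^1(x_2,x_4)\\ x_1G_1^1(x_1,x_3)\\ x_2G_1^1(x_2,x_4)\end{pmatrix}\\ &+\begin{pmatrix}0\\ x_3F_3^0(x_3)\\0\\ x_3G_3^0(x_3)\end{pmatrix}+\begin{pmatrix}x_3F_3^1(x_3)\\ x_4F_3^1(x_4)\\ x_3G_3^1(x_3)\\ x_4G_3^1(x_4)\end{pmatrix},\end{aligned}$$ where the $F$'s and $G$'s are arbitrary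 formal power series in the indicated variables. That is, for every $k\ge1$, if $\mathcal{C}_k\subset\mathcal{P}^4_k$ denotes the set of homogeneous components of degree $k+1$ of all maps $F(x)-\mathsf{N}x$ obtained from this expression for $F(x)$ as $F_{1,2}^0,F_{1,4}^0,F_{2,3}^0,F_{3,4}^0,F_1^0,F_1^1,F_3^0,F_3^1$ and $G_{1,2}^0,G_{1,4}^0,G_{2,3}^0,G_{3,4}^0,G_1^0,G_1^1,G_3^0,G_3^1$ range over all formal power series in their indicated variables, then $\mathcal{P}^4_k=\operatorname{im}\left(\nabla_{\mathsf{N}}|_{\mathcal{P}^4_k}\right)\oplus\mathcal{C}_k$.
   Context: $P_k$ is the space of real homogeneous polynomials of degree $k$ in $x_1,\dots,x_n$ and $\mathcal{P}^n_k=P_{k+1}\otimes\mathbb{R}^n$ (here $n=4$). For an $n\times n$ matrix $A$, the homological operator is $(\nabla_A\varphi)(x)=A\varphi(x)-\varphi(Ax)$; it preserves each $\mathcal{P}^n_k$. A map $f=Ax+\sum_{k\ge1}f_k$ with $f_k\in\mathcal{P}^n_k$ is said to be in normal form (with style $\mathcal{C}$) with respect to its linear part $A$ if $f_k\in\mathcal{C}_k$ for all $k\ge1$, where $\mathcal{P}^n_k=\operatorname{im}\nabla_A\oplus\mathcal{C}_k$. *)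

(* Defs.v *)
From HB Require Import structures.
From mathcomp Require Import all_boot all_order all_algebra.
From mathcomp Require Import boolp functions reals.
From mathcomp Require Import mpoly.

Set Implicit Arguments.
Unset Strict Implicit.
Unset Printing Implicit Defensive.

Import GRing.Theory.
Local Open Scope ring_scope.

(* P_{k+1} (x) R^n, a homogeneous vector field being the finite function of
   its n components. *)
Notation homog_vfield n R k := {ffun 'I_n -> dhomog n R k.+1}.

Section HomologicalOperator.
Variables (R : realType) (n : nat) (A : 'M[R]_n).

(* The tuple of linear forms x |-> A x, so that p \mPo linear_forms is p(Ax). *)
Definition linear_forms : n.-tuple {mpoly R[n]} :=
  [tuple \sum_(j < n) A i j *: 'X_j | i < n].

Lemma comp_linear_forms_homog d (p : dhomog n R d) :
  (p : {mpoly R[n]}) \mPo linear_forms \is d.-homog.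
Proof.
have homog_form i : tnth linear_forms i \is 1.-homog.
  rewrite tnth_mktuple; apply: rpred_sum => j _; apply: rpredZ.
  by rewrite dhomogX /= mdeg1.
rewrite comp_mpolyEX big_seq; apply: rpred_sum => m pm; apply: rpredZ.
have <- : mdeg m = d by exact: (dhomogP _ _ _ (dhomog_is_dhomog p)).
rewrite comp_mpolyX mdegE.
apply: (big_ind2 (fun (q : {mpoly R[n]}) e => q \is e.-homog)).
- exact: dhomog1.
- by move=> *; apply: dhomogM.
- by move=> i _; rewrite -[in X in X.-homog](mul1n (m i)); apply: dhomogMn.
Qed.

Definition comp_linear d (p : dhomog n R d) : dhomog n R d :=
  DHomog (comp_linear_forms_homog p).

Variable k : nat.

Definition nabla (phi : homog_vfield n R k) : homog_vfield n R k :=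
  [ffun i => \sum_(j < n) A i j *: phi j - comp_linear (phi i)].

Lemma nabla_is_linear : linear nabla.
Proof.
have compP a : {morph @comp_linear k.+1 : p q / a *: p + q}.
  by move=> p q; apply: val_inj; rewrite /= linearP.
move=> a phi psi; apply/ffunP => i; rewrite !ffunE compP scalerBr scaler_sumr.
rewrite opprD addrACA; congr (_ + _); rewrite -big_split /=.
by apply: eq_bigr => j _; rewrite !ffunE scalerDr !scalerA mulrC.
Qed.

HB.instance Definition _ :=
  GRing.isLinear.Build R (homog_vfield n R k) (homog_vfield n R k) _ nabla
    nabla_is_linear.

End HomologicalOperator.

(* Formal power series, as families of coefficients indexed by monomials; the
   vector space structure is the pointwise one. *)
Definition series (n : nat) (R : realType) := 'X_{1..n} -> R^o.

HB.instance Definition _ n (R : realType) :=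
  GRing.Lmodule.copy (series n R) ('X_{1..n} -> R^o).

Section Series.
Variables (R : realType) (n : nat).

Definition series_var (i : 'I_n) : series n R := fun m => (m == U_(i)%MM)%:R.

(* Cauchy product; compare mcoeffM. *)
Definition series_mul (f g : series n R) : series n R := fun m =>
  \sum_(u : 'X_{1..n < (mdeg m).+1, (mdeg m).+1} | m == (u.1 + u.2)%MM)
    f u.1 * g u.2.

(* [series_at f v] is the series f(x_{v_0}, ..., x_{v_(r-1)}): the monomial
   prod_j y_j^{u_j} becomes prod_j x_{v_j}^{u_j}, whose exponent in x_i is the
   sum of the u_j with v_j = i. *)
Definition series_at r (f : series r R) (v : r.-tuple 'I_n) : series n R :=
  fun m => \sum_(u : 'X_{1..r < (mdeg m).+1} |
      [multinom (\sum_(j < r | tnth v j == i) u j)%N | i < n] == m) f u.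

Lemma series_homog_part_subproof d (f : series n R) :
  \sum_(m : 'X_{1..n < d.+1} | mdeg m == d) f m *: 'X_[R, m] \is d.-homog.
Proof.
by apply: rpred_sum => m md; apply: rpredZ; rewrite dhomogX.
Qed.

Definition series_homog_part d (f : series n R) : dhomog n R d :=
  DHomog (series_homog_part_subproof d f).

(* The homogeneous component of degree k + 1 of a formal vector field. *)
Definition vfield_part k (f : 'cV[series n R]_n) : homog_vfield n R k :=
  [ffun i => series_homog_part k.+1 (f i ord0)].

Definition linear_vfield (A : 'M[R]_n) : 'cV[series n R]_n :=
  \col_i \sum_(j < n) A i j *: series_var j.

End Series.

Notation "''x_' i" := (series_var _ i)
  (at level 8, i at level 2, format "''x_' i").
Infix "*s" := series_mul (at level 40, left associativity).
Infix "\at" := series_at (at level 30, no associativity).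

Definition N22 (R : realType) : 'M[R]_4 :=
  \matrix_(i, j) nth 0 (nth [::] [:: [:: 0; 1; 0; 0];
                                     [:: 0; 0; 0; 0];
                                     [:: 0; 0; 0; 1];
                                     [:: 0; 0; 0; 0]] i) j.

(* The coefficients F^0_{1,2}, ..., F^1_3 (or the G's). *)
Record nf_coefs (R : realType) := NfCoefs {
  c12_0 : series 4 R;
  c14_0 : series 3 R;
  c23_0 : series 3 R;
  c34_0 : series 2 R;
  c1_0  : series 2 R;
  c1_1  : series 2 R;
  c3_0  : series 1 R;
  c3_1  : series 1 R }.

Section NormalForm.
Variable R : realType.

Definition col4 (a b c d : series 4 R) : 'cV[series 4 R]_4 :=
  \col_i nth 0 [:: a; b; c; d] i.

(* Ordinals start from 0: i1, ..., i4 index the coordinates x_1, ..., x_4. *)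
Let i1 : 'I_4 := @Ordinal 4 0 isT.
Let i2 : 'I_4 := @Ordinal 4 1 isT.
Let i3 : 'I_4 := @Ordinal 4 2 isT.
Let i4 : 'I_4 := @Ordinal 4 3 isT.

Definition N22_form (F G : nf_coefs R) : 'cV[series 4 R]_4 :=
  linear_vfield (N22 R)
  + col4 0
         ('x_i1 *s 'x_i2 *s (c12_0 F \at [tuple i1; i2; i3; i4]))
         0
         ('x_i1 *s 'x_i2 *s (c12_0 G \at [tuple i1; i2; i3; i4]))
  + col4 0
         ('x_i1 *s 'x_i4 *s (c14_0 F \at [tuple i1; i3; i4]))
         0
         ('x_i1 *s 'x_i4 *s (c14_0 G \at [tuple i1; i3; i4]))
  + col4 0
         ('x_i2 *s 'x_i3 *s (c23_0 F \at [tuple i2; i3; i4]))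
         0
         ('x_i2 *s 'x_i3 *s (c23_0 G \at [tuple i2; i3; i4]))
  + col4 0
         ('x_i3 *s 'x_i4 *s (c34_0 F \at [tuple i3; i4]))
         0
         ('x_i3 *s 'x_i4 *s (c34_0 G \at [tuple i3; i4]))
  + col4 0
         ('x_i1 *s (c1_0 F \at [tuple i1; i3]))
         0
         ('x_i1 *s (c1_0 G \at [tuple i1; i3]))
  + col4 ('x_i1 *s (c1_1 F \at [tuple i1; i3]))
         ('x_i2 *s (c1_1 F \at [tuple i2; i4]))
         ('x_i1 *s (c1_1 G \at [tuple i1; i3]))
         ('x_i2 *s (c1_1 G \at [tuple i2; i4]))
  + col4 0
         ('x_i3 *s (c3_0 F \at [tuple i3]))
         0
         ('x_i3 *s (c3_0 G \at [tuple i3]))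
  + col4 ('x_i3 *s (c3_1 F \at [tuple i3]))
         ('x_i4 *s (c3_1 F \at [tuple i4]))
         ('x_i3 *s (c3_1 G \at [tuple i3]))
         ('x_i4 *s (c3_1 G \at [tuple i4])).

End NormalForm.

(* Main.v *)
(* The complement is the kernel of the homological operator of the transpose of
   N.  Write s and r for composition with N and with its transpose, i.e.
   (s p)(x) = p(x2, 0, x4, 0) and (r p)(x) = p(0, x1, 0, x3).  On forms of
   positive degree s s = r r = 0, and N N^T N = N gives s r s = s.  Hence
     im nabla_N = {phi2 = - s phi1, phi4 = - s phi3},
     ker nabla_(N^T) = {phi1 = r phi2, phi3 = r phi4},
   and these are complementary because 1 + r s is invertible, r s being
   idempotent.  Finally, every monomial other than 1 occurs in exactly one of
   the eight terms of the second component of the normal form, so that component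
   is arbitrary, and its image under r is the first component; likewise for the
   fourth and third components. *)
From HB Require Import structures.
Require Import Defs.
From mathcomp Require Import all_boot all_order all_algebra.
From mathcomp Require Import boolp functions reals.
From mathcomp Require Import mpoly.

Set Implicit Arguments.
Unset Strict Implicit.
Unset Printing Implicit Defensive.

Import GRing.Theory Num.Theory.
Local Open Scope ring_scope.

Local Notation i1 := (@Ordinal 4 0 isT).
Local Notation i2 := (@Ordinal 4 1 isT).
Local Notation i3 := (@Ordinal 4 2 isT).
Local Notation i4 := (@Ordinal 4 3 isT).

Lemma forall_ord4 (P : pred 'I_4) :
  [forall i, P i] = [&& P i1, P i2, P i3 & P i4].
Proof.
apply/forallP/and4P => [P_ | [P1 P2 P3 P4] [[|[|[|[|//]]]] lt_i]].
- by split; apply: P_.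
- by rewrite (bool_irrelevance lt_i isT).
- by rewrite (bool_irrelevance lt_i isT).
- by rewrite (bool_irrelevance lt_i isT).
- by rewrite (bool_irrelevance lt_i isT).
Qed.

Lemma big_ord4 (T : Type) (idx : T) (op : Monoid.law idx) (F : 'I_4 -> T) :
  \big[op/idx]_(i < 4) F i = op (op (op (F i1) (F i2)) (F i3)) (F i4).
Proof.
rewrite !big_ord_recr big_ord0 /= Monoid.mul1m.
by do !congr (op _ _); congr F; apply: val_inj.
Qed.

(** * Composition of forms with linear maps *)

Lemma comp_mpoly_comp (R : comNzRingType) (n k l : nat) (p : {mpoly R[n]})
    (lp : n.-tuple {mpoly R[k]}) (lq : k.-tuple {mpoly R[l]}) :
  (p \mPo lp) \mPo lq = p \mPo [tuple tnth lp i \mPo lq | i < n].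
Proof.
rewrite (comp_mpolyE p lp) raddf_sum comp_mpolyE.
apply: eq_bigr => m _ /=; rewrite linearZ /= rmorph_prod; congr (_ *: _).
by apply: eq_bigr => i _; rewrite rmorphXn /= tnth_mktuple.
Qed.

Lemma comp_linear_is_linear (R : realType) (n : nat) (A : 'M[R]_n) (d : nat) :
  linear (@comp_linear R n A d).
Proof. by move=> a p q; apply: val_inj; rewrite /= linearP. Qed.

HB.instance Definition _ (R : realType) (n : nat) (A : 'M[R]_n) (d : nat) :=
  GRing.isLinear.Build R (dhomog n R d) (dhomog n R d) _ (@comp_linear R n A d)
    (comp_linear_is_linear A (d := d)).

Lemma comp_linearM (R : realType) (n d : nat) (A B : 'M[R]_n)
    (p : dhomog n R d) :
  comp_linear A (comp_linear B p) = comp_linear (B *m A) p.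
Proof.
apply: val_inj; rewrite /= comp_mpoly_comp; congr (_ \mPo _).
apply: eq_from_tnth => i; rewrite !tnth_mktuple raddf_sum /=.
under eq_bigr => j _ do
  rewrite linearZ /= comp_mpolyXU -tnth_nth tnth_mktuple scaler_sumr.
rewrite exchange_big /=; apply: eq_bigr => j _; rewrite mxE scaler_suml.
by apply: eq_bigr => l _; rewrite scalerA.
Qed.

(** Positive degree puts a positive exponent in every monomial of [p], hence a zero factor; a
    constant would survive. *)
Lemma comp_linear0 (R : realType) (n d : nat) (p : dhomog n R d.+1) :
  comp_linear 0 p = 0.
Proof.
apply: val_inj; rewrite /= comp_mpolyE big_seq big1 // => m /= pm.
have := dhomogP _ _ _ (dhomog_is_dhomog p) _ pm.
rewrite /= mdegE => sum_m.
have [i mi] : exists i, m i != 0%N.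
  apply/existsP; apply: contra_eqT sum_m; rewrite negb_exists => /forallP m0.
  by rewrite big1 // => i _; apply/eqP/negbNE.
rewrite (bigD1 i) //= tnth_mktuple big1 ?expr0n ?(negbTE mi) ?mul0r ?scaler0 //.
by move=> j _; rewrite mxE scale0r.
Qed.

(** * The matrix [N22] and the homological operators of it and its transpose *)

Lemma N22_delta (R : realType) : N22 R = delta_mx i1 i2 + delta_mx i3 i4.
Proof.
apply/matrixP => i j; rewrite !mxE -!val_eqE /=.
by case: i j => [[|[|[|[|//]]]] ?] [[|[|[|[|//]]]] ?] /=;
  rewrite ?addr0 ?add0r.
Qed.

(** In matrix units every product of two units is a unit or zero. The pair of identities serves as
    one rewriting rule. *)
Lemma N22E (R : realType) :
  (N22 R *m N22 R = 0) * (N22 R *m (N22 R)^T *m N22 R = N22 R).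
Proof.
rewrite N22_delta [(_ + _)^T]linearD /= !trmx_delta.
by rewrite !(mulmxDl, mulmxDr, mul_delta_mx_cond, mulr0n, mulr1n, addr0, add0r,
             mul0mx).
Qed.

Lemma comp_N22K (R : realType) (d : nat) (p : dhomog 4 R d) :
  comp_linear (N22 R) (comp_linear (N22 R)^T (comp_linear (N22 R) p)) =
  comp_linear (N22 R) p.
Proof. by rewrite !comp_linearM mulmxA N22E. Qed.

Lemma comp_N22_N22 (R : realType) (d : nat) (p : dhomog 4 R d.+1) :
  comp_linear (N22 R) (comp_linear (N22 R) p) = 0.
Proof. by rewrite comp_linearM N22E comp_linear0. Qed.

Lemma comp_trN22_trN22 (R : realType) (d : nat) (p : dhomog 4 R d.+1) :
  comp_linear (N22 R)^T (comp_linear (N22 R)^T p) = 0.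
Proof. by rewrite comp_linearM -trmx_mul N22E trmx0 comp_linear0. Qed.

Lemma nabla_N22E (R : realType) (k : nat) (phi : homog_vfield 4 R k) :
  let s := comp_linear (N22 R) (d := k.+1) in
  [/\ nabla (N22 R) phi i1 = phi i2 - s (phi i1),
      nabla (N22 R) phi i2 = - s (phi i2),
      nabla (N22 R) phi i3 = phi i4 - s (phi i3)
    & nabla (N22 R) phi i4 = - s (phi i4)].
Proof.
by split; rewrite ffunE big_ord4 !mxE /= ?scale0r ?scale1r ?addr0 ?add0r.
Qed.

Lemma nabla_trN22E (R : realType) (k : nat) (phi : homog_vfield 4 R k) :
  let r := comp_linear (N22 R)^T (d := k.+1) in
  [/\ nabla (N22 R)^T phi i1 = - r (phi i1),
      nabla (N22 R)^T phi i2 = phi i1 - r (phi i2),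
      nabla (N22 R)^T phi i3 = - r (phi i3)
    & nabla (N22 R)^T phi i4 = phi i3 - r (phi i4)].
Proof.
by split; rewrite ffunE big_ord4 !mxE /= ?scale0r ?scale1r ?addr0 ?add0r.
Qed.

Lemma vfield4P (R : realType) (k : nat) (phi psi : homog_vfield 4 R k) :
  [/\ phi i1 = psi i1, phi i2 = psi i2, phi i3 = psi i3 & phi i4 = psi i4] ->
  phi = psi.
Proof.
case=> e1 e2 e3 e4; apply/ffunP => i; apply/eqP; move: i; apply/forallP.
by rewrite forall_ord4 e1 e2 e3 e4 !eqxx.
Qed.

(** * Image, kernel and their complementarity *)

Lemma limg_nabla_N22 (R : realType) (k : nat) (phi : homog_vfield 4 R k) :
  phi \in limg (linfun (nabla (N22 R) (k := k))) <->
  phi i2 = - comp_linear (N22 R) (phi i1) /\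
  phi i4 = - comp_linear (N22 R) (phi i3).
Proof.
split=> [/memv_imgP[psi _ ->] | [e2 e4]].
  rewrite lfunE /=; case: (nabla_N22E psi) => -> -> -> ->.
  by rewrite !linearB /= !comp_N22_N22 oppr0 !subr0.
(* A field (0, a, 0, b) is sent to (a, - s a, b, - s b), with s the composition with [N22]; take a
   and b to be the first and third components of [phi]. *)
apply/memv_imgP; pose s := [:: 0; phi i1; 0; phi i3].
exists [ffun i : 'I_4 => nth 0 s i]; first exact: memvf.
apply: vfield4P; rewrite lfunE /=; case: (nabla_N22E [ffun i : 'I_4 => nth 0 s i]).
by move=> -> -> -> ->; rewrite !ffunE /= !linear0 !addr0.
Qed.

Lemma lker_nabla_trN22 (R : realType) (k : nat) (phi : homog_vfield 4 R k) :
  phi \in lker (linfun (nabla (N22 R)^T (k := k))) <->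
  phi i1 = comp_linear (N22 R)^T (phi i2) /\
  phi i3 = comp_linear (N22 R)^T (phi i4).
Proof.
rewrite memv_ker lfunE /=; case: (nabla_trN22E phi) => n1 n2 n3 n4.
split=> [/eqP n0 | [e1 e3]].
  by split; apply/eqP; rewrite -subr_eq0 -?n2 -?n4 n0 ffunE.
(* Components 1 and 3 vanish because composing twice with the transpose gives zero. *)
apply/eqP/vfield4P; rewrite n1 n2 n3 n4 e1 e3 !comp_trN22_trN22 !subrr !oppr0.
by rewrite !ffunE.
Qed.

(* On forms, write [r] for composition with the transpose of [N22] and [s] for
   composition with [N22]. As [r s] is idempotent, [w - r (s w) / 2] is the
   preimage of [w] under [1 + r s]. *)
Lemma comp_N22_solve (R : realType) (d : nat) (u v : dhomog 4 R d) :
  exists a, a + comp_linear (N22 R)^T (v + comp_linear (N22 R) a) = u.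
Proof.
(* The equation to solve reads (1 + r s) a = w. *)
have [w wE] : {w | w = u - comp_linear (N22 R)^T v} by eexists.
exists (w - 2^-1 *: comp_linear (N22 R)^T (comp_linear (N22 R) w)).
rewrite ![comp_linear _ (_ - _)]linearB linearD linearB !linearZ /= comp_N22K.
set rsw := comp_linear _ (comp_linear _ w).
rewrite addrCA -addrA [X in _ + (_ + X)](_ : _ = 0); last first.
  rewrite addrC -addrA -scalerDl -div1r -splitr.
  by rewrite scale1r subrr.
by rewrite addr0 wE addrC subrK.
Qed.

Lemma nabla_N22_sum (R : realType) (k : nat) :
  (limg (linfun (nabla (N22 R) (k := k))) +
   lker (linfun (nabla (N22 R)^T (k := k))))%VS = fullv.
Proof.
apply/eqP; rewrite eqEsubv subvf; apply/subvP => phi _.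
(* Subtracting the image element (a1, - s a1, a3, - s a3) leaves a kernel element exactly when phi1
   - a1 = r (phi2 + s a1), and likewise for a3. *)
have [a1 a1E] := comp_N22_solve (phi i1) (phi i2).
have [a3 a3E] := comp_N22_solve (phi i3) (phi i4).
pose psi : homog_vfield 4 R k :=
  [ffun i : 'I_4 => nth 0 [:: a1; - comp_linear (N22 R) a1;
                             a3; - comp_linear (N22 R) a3] i].
apply/memv_addP; exists psi.
  by apply/limg_nabla_N22; rewrite !ffunE.
exists (phi - psi); last by rewrite addrC subrK.
apply/lker_nabla_trN22; rewrite !ffunE /= !opprK.
by split; apply/eqP; rewrite subr_eq addrC ?a1E ?a3E.
Qed.

Lemma nabla_N22_directv (R : realType) (k : nat) :
  directv (limg (linfun (nabla (N22 R) (k := k))) +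
           lker (linfun (nabla (N22 R)^T (k := k)))).
Proof.
apply/directv_addP/eqP; rewrite -subv0; apply/subvP => phi.
rewrite memv_cap => /andP[/limg_nabla_N22[e2 e4] /lker_nabla_trN22[e1 e3]].
(* With [r], [s] as in [comp_N22_solve]: [s r s = s] and [p = - r s p], so
   [s p = - s p]. *)
have inj (p : dhomog 4 R k.+1) :
    p = comp_linear (N22 R)^T (- comp_linear (N22 R) p) -> p = 0.
  set q := comp_linear _ p; rewrite linearN /= => e.
  have /eqP : q = - q.
    by rewrite {1}/q e linearN /= comp_N22K.
  rewrite -addr_eq0 -mulr2n -scaler_nat scaler_eq0 pnatr_eq0 /= => /eqP q0.
  by rewrite e q0 linear0 oppr0.
have phi1 : phi i1 = 0 by apply: inj; rewrite -e2.
have phi3 : phi i3 = 0 by apply: inj; rewrite -e4.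
rewrite memv0; apply/eqP/vfield4P.
by rewrite e2 e4 phi1 phi3 linear0 oppr0 !ffunE.
Qed.

(** * Coefficients of power series and of composed forms *)

Lemma mcoeff_homog_part (R : realType) (n d : nat) (f : series n R)
    (m : 'X_{1..n}) :
  (series_homog_part d f : {mpoly R[n]})@_m = if mdeg m == d then f m else 0.
Proof.
rewrite /= raddf_sum /=; under eq_bigr => u _ do rewrite mcoeffZ mcoeffX.
case: eqP => [<-|md]; last first.
  rewrite big1 // => u /eqP ud; case: eqP => [um|]; last by rewrite mulr0.
  by case: md; rewrite -um.
rewrite (bigD1 (BMultinom (ltnSn (mdeg m)))) //= eqxx mulr1 big1 ?addr0 // => u.
case/andP=> _ um; case: eqP => [e|]; last by rewrite mulr0.
by case/eqP: um; apply: val_inj.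
Qed.

Lemma dhomog_eqP (R : realType) (n d : nat) (p q : dhomog n R d) :
  (forall m, mdeg m = d ->
    (p : {mpoly R[n]})@_m = (q : {mpoly R[n]})@_m) -> p = q.
Proof.
move=> pq; apply: val_inj; apply/mpolyP => m /=.
have [/pq // | md] := eqVneq (mdeg m) d.
by rewrite !(dhomog_nemf_coeff (dhomog_is_dhomog _) md).
Qed.

(** At [U_(i)] this is convertible with [series_var i], so the factors in front of the coefficient
    series become monomials. *)
Definition series_mon (R : realType) (n : nat) (a : 'X_{1..n}) : series n R :=
  fun m => (m == a)%:R.

Lemma series_mon_mulE (R : realType) (n : nat) (a : 'X_{1..n})
    (f : series n R) (m : 'X_{1..n}) :
  (series_mon R a *s f) m = if (a <= m)%MM then f (m - a)%MM else 0.
Proof.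
rewrite /series_mul /series_mon; case: ifPn => [am | nam]; last first.
  rewrite big1 // => u /eqP mu; case: eqP => [ua|]; last by rewrite mul0r.
  by case/negP: nam; rewrite mu ua lem_addr.
have lta : (mdeg a < (mdeg m).+1)%N.
  by rewrite ltnS -(submK am) mdegD leq_addl.
have ltma : (mdeg (m - a)%MM < (mdeg m).+1)%N.
  by rewrite ltnS -{2}(submK am) mdegD leq_addr.
rewrite (bigD1 (BMultinom lta, BMultinom ltma)) /=; last by rewrite addmC submK.
rewrite eqxx mul1r big1 ?addr0 // => -[u v] /= /andP[/eqP mE neq].
case: eqP => [ua|]; last by rewrite mul0r.
case/eqP: neq; congr (_, _); apply: val_inj => //=.
have := congr1 (fun x => x - a)%MM mE.
by rewrite ua addmC addmK => ->.
Qed.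

Lemma series_monM (R : realType) (n : nat) (a b : 'X_{1..n}) :
  series_mon R a *s series_mon R b = series_mon R (a + b)%MM.
Proof.
apply/funext => m; rewrite series_mon_mulE /series_mon.
case: ifPn => [am | nam].
  congr (_%:R); congr (nat_of_bool _).
  by apply/eqP/eqP => [<- | ->]; rewrite addmC ?submK ?addmK.
by case: eqP => // mE; case/negP: nam; rewrite mE lem_addr.
Qed.

(** The exponent map of the substitution in [series_at]. For distinct variables it has the left
    inverse [mnm_restr], so each sum in [series_at] has at most one term. *)
Definition mnm_at (n r : nat) (v : r.-tuple 'I_n) (u : 'X_{1..r}) : 'X_{1..n} :=
  [multinom (\sum_(j < r | tnth v j == i) u j)%N | i < n].

Definition mnm_restr (n r : nat) (v : r.-tuple 'I_n) (m : 'X_{1..n}) :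
  'X_{1..r} := [multinom m (tnth v j) | j < r].

Lemma mnm_atK (n r : nat) (v : r.-tuple 'I_n) :
  uniq v -> cancel (mnm_at v) (mnm_restr v).
Proof.
move=> uv u; apply/mnmP => j; rewrite !mnmE (big_pred1 j) // => l.
by apply/eqP/eqP => [/(tuple_uniqP _ uv) -> | ->].
Qed.

(** Ensures that the only relevant exponent passes the degree bound in [series_at]. *)
Lemma mdeg_restr (n r : nat) (v : r.-tuple 'I_n) (m : 'X_{1..n}) :
  mnm_at v (mnm_restr v m) = m -> mdeg (mnm_restr v m) = mdeg m.
Proof.
move=> {2}<-; rewrite !mdegE; under [RHS]eq_bigr => i _ do rewrite mnmE.
rewrite (exchange_big_dep predT) //=; apply: eq_bigr => j _.
by rewrite (big_pred1 (tnth v j)) => [|i] //=; rewrite eq_sym.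
Qed.

Lemma series_atE (R : realType) (n r : nat) (f : series r R)
    (v : r.-tuple 'I_n) (m : 'X_{1..n}) :
  uniq v ->
  (f \at v) m =
  if mnm_at v (mnm_restr v m) == m then f (mnm_restr v m) else 0.
Proof.
move=> uv; rewrite /series_at -/(mnm_at v _).
case: eqP => [mE | mE]; last first.
  rewrite big1 // => u /eqP uE; case: mE.
  by rewrite -uE (mnm_atK uv).
have lt : (mdeg (mnm_restr v m) < (mdeg m).+1)%N by rewrite mdeg_restr.
rewrite (big_pred1 (BMultinom lt)) // => u /=.
apply/eqP/eqP => [uE | ->//]; apply: val_inj => /=.
by have := congr1 (mnm_restr v) uE; rewrite (mnm_atK uv).
Qed.

(* The monomials [x^m] of [x^a f(x_{v_0}, ..., x_{v_(r-1)})]. *)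
Definition in_block (n r : nat) (a : 'X_{1..n}) (v : r.-tuple 'I_n)
    (m : 'X_{1..n}) : bool :=
  (a <= m)%MM && (mnm_at v (mnm_restr v (m - a)) == m - a)%MM.

Lemma blockE (R : realType) (n r : nat) (a : 'X_{1..n}) (v : r.-tuple 'I_n)
    (f : series r R) (m : 'X_{1..n}) :
  uniq v ->
  (series_mon R a *s (f \at v)) m =
  if in_block a v m then f (mnm_restr v (m - a)%MM) else 0.
Proof.
move=> uv; rewrite series_mon_mulE series_atE // /in_block.
by case: (a <= m)%MM.
Qed.

(** Supplies the coefficient series with which one term of the normal form reproduces [p] on its
    block. *)
Lemma block_mcoeffE (R : realType) (n r : nat) (a : 'X_{1..n})
    (v : r.-tuple 'I_n) (p : {mpoly R[n]}) (m : 'X_{1..n}) :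
  uniq v ->
  (series_mon R a *s ((fun u => p@_(a + mnm_at v u)%MM) \at v)) m =
  if in_block a v m then p@_m else 0.
Proof.
move=> uv; rewrite blockE //; case: ifP => // /andP[am /eqP ->].
by rewrite addmC submK.
Qed.

Lemma mnm_atP (n r : nat) (v : r.-tuple 'I_n) (m : 'X_{1..n}) :
  uniq v ->
  (mnm_at v (mnm_restr v m) == m) = [forall i, (i \in v) || (m i == 0%N)].
Proof.
move=> uv; apply/eqP/forallP => [<- i | m0].
  rewrite -implyNb; apply/implyP => iv; rewrite mnmE big1 // => j /eqP vj.
  by case/negP: iv; rewrite -vj mem_tnth.
apply/mnmP => i; rewrite mnmE; have := m0 i.
have [/tnthP[j ->] _ | iv /= /eqP ->] := boolP (i \in v).
  rewrite (big_pred1 j) ?mnmE // => l.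
  by apply/eqP/eqP => [/(tuple_uniqP _ uv) -> | ->].
rewrite big1 // => j /eqP vj.
by case/negP: iv; rewrite -vj mem_tnth.
Qed.

(* Exponent of the only monomial that x |-> (0, x_1, 0, x_3) can send to [x^m]. *)
Definition push_mnm (m : 'X_{1..4}) : 'X_{1..4} :=
  [multinom nth 0%N [:: 0; m i1; 0; m i3]%N i | i < 4].

Lemma mcoeff_comp_trN22 (R : realType) (d : nat) (p : dhomog 4 R d)
    (m : 'X_{1..4}) :
  (comp_linear (N22 R)^T p : {mpoly R[4]})@_m =
  if (m i2 == 0%N) && (m i4 == 0%N) then (p : {mpoly R[4]})@_(push_mnm m) else 0.
Proof.
rewrite /= comp_mpolyE raddf_sum /=.
transitivity (\sum_(u <- msupp (p : {mpoly R[4]})) (p : {mpoly R[4]})@_u *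
  (if (m i2 == 0%N) && (m i4 == 0%N) then (u == push_mnm m)%:R else 0)).
  apply: eq_bigr => u _; rewrite mcoeffZ; congr (_ * _).
  have forms (i : 'I_4) : tnth (linear_forms (N22 R)^T) i =
      nth 0 [:: 0; 'X_i1; 0; 'X_i3] i.
    rewrite tnth_mktuple big_ord4 !mxE /=.
    by case: i => [[|[|[|[|//]]]] ?] /=;
      rewrite ?scale0r ?scale1r ?addr0 ?add0r.
  (* Since [0 ^+ e] is 1 only at e = 0, x^u survives only if its exponents in x1 and x3 vanish, and
     then becomes x1^(u2) x3^(u4). *)
  rewrite big_ord4 !forms /= !expr0n.
  have -> : (u == push_mnm m) =
     [forall i, u i == nth 0%N [:: 0; m i1; 0; m i3]%N i].
    apply/eqP/forallP => [-> i | u_]; first by rewrite mnmE.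
    by apply/mnmP => i; rewrite mnmE; apply/eqP.
  rewrite forall_ord4 /=.
  case: (u i1 == 0%N); last by rewrite !mul0r mcoeff0 /=; case: ifP.
  case: (u i3 == 0%N); last first.
    by rewrite mulr0 !mul0r mcoeff0 /= andbF; case: ifP.
  rewrite mul1r mulr1 !mpolyXn -mpolyXD mcoeffX.
  have -> : ((U_(i1) *+ u i2 + U_(i3) *+ u i4)%MM == m) =
     [forall i : 'I_4, nth 0%N [:: u i2; 0; u i4; 0]%N i == m i].
    apply/eqP/forallP => [<- i | u_].
      rewrite !(mnmE, mulmnE, mnm1E) -!val_eqE /=.
      by case: i => [[|[|[|[|//]]]] ?] /=; rewrite ?(mul1n, mul0n, addn0).
    apply/mnmP => i; rewrite -(eqP (u_ i)) !(mnmE, mulmnE, mnm1E) -!val_eqE /=.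
    by case: {u_}i => [[|[|[|[|//]]]] ?] /=; rewrite ?(mul1n, mul0n, addn0).
  rewrite forall_ord4 /= !(eq_sym 0%N).
  by do 4! case: (_ == _).
case: ifP => _; last by rewrite big1 // => u _; rewrite mulr0.
rewrite [in RHS](mpolyE p) raddf_sum /=.
by apply: eq_bigr => u _; rewrite mcoeffZ mcoeffX.
Qed.

(** * The components of the normal form *)

Definition nf_head (R : realType) (F : nf_coefs R) : series 4 R :=
  series_mon R U_(i1) *s (c1_1 F \at [tuple i1; i3])
  + series_mon R U_(i3) *s (c3_1 F \at [tuple i3]).

(** Beyond the linear part, components 1 and 2 are [nf_head] and [nf_tail] of F, components 3 and 4
    those of G. *)
Definition nf_tail (R : realType) (F : nf_coefs R) : series 4 R :=
  series_mon R (U_(i1) + U_(i2)) *s (c12_0 F \at [tuple i1; i2; i3; i4])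
  + series_mon R (U_(i1) + U_(i4)) *s (c14_0 F \at [tuple i1; i3; i4])
  + series_mon R (U_(i2) + U_(i3)) *s (c23_0 F \at [tuple i2; i3; i4])
  + series_mon R (U_(i3) + U_(i4)) *s (c34_0 F \at [tuple i3; i4])
  + series_mon R U_(i1) *s (c1_0 F \at [tuple i1; i3])
  + series_mon R U_(i2) *s (c1_1 F \at [tuple i2; i4])
  + series_mon R U_(i3) *s (c3_0 F \at [tuple i3])
  + series_mon R U_(i4) *s (c3_1 F \at [tuple i4]).

Lemma vfield_part_N22_form (R : realType) (k : nat) (F G : nf_coefs R) :
  vfield_part k (N22_form F G - linear_vfield (N22 R)) =
  [ffun i : 'I_4 => series_homog_part k.+1
    (nth 0 [:: nf_head F; nf_tail F; nf_head G; nf_tail G] i)].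
Proof.
have form_eq : N22_form F G - linear_vfield (N22 R) =
    col4 (nf_head F) (nf_tail F) (nf_head G) (nf_tail G).
  rewrite /N22_form -!(addrA (linear_vfield _)) addrC subrK.
  rewrite /nf_head /nf_tail -!series_monM.
  apply/matrixP => -[[|[|[|[|//]]]] ?] j; rewrite !mxE /=;
    by rewrite ?addr0 ?add0r.
by apply/ffunP => i; rewrite !ffunE form_eq mxE.
Qed.

(** Turns block membership into conditions on four exponents, open to case analysis. *)
Lemma in_blockE (r : nat) (a : 'X_{1..4}) (v : r.-tuple 'I_4) (m : 'X_{1..4}) :
  uniq v ->
  in_block a v m = [forall i, (a i <= m i)%N] &&
                   [forall i, (i \in v) || (m i - a i == 0)%N].
Proof.
move=> uv; rewrite /in_block mnm_atP //; congr (_ && _).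
by apply: eq_forallb => i; rewrite mnmE.
Qed.

(** A pushed monomial involves only x2 and x4, so only the tail blocks of [c1_1] and [c3_1] can
    contain it; these match the two head blocks. *)
Lemma nf_head_tail (R : realType) (F : nf_coefs R) (m : 'X_{1..4}) :
  nf_head F m =
  if (m i2 == 0%N) && (m i4 == 0%N) then nf_tail F (push_mnm m) else 0.
Proof.
have addE (f g : series 4 R) u : (f + g) u = f u + g u by [].
rewrite /nf_head /nf_tail !addE !blockE //.
rewrite !in_blockE // !forall_ord4 !inE !mnmE -!val_eqE /=.
have -> : mnm_restr [tuple i2; i4] (push_mnm m - U_(i2)) =
          mnm_restr [tuple i1; i3] (m - U_(i1)).
  by apply/mnmP => -[[|[|//]] ?]; rewrite !mnmE -!val_eqE /= ?subn0.
have -> : mnm_restr [tuple i4] (push_mnm m - U_(i4)) =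
          mnm_restr [tuple i3] (m - U_(i3)).
  by apply/mnmP => -[[|//] ?]; rewrite !mnmE -!val_eqE /= ?subn0.
rewrite !(addn0, subn0, leq0n, andbT, andbF) !(addr0, add0r).
case: (m i2 == 0%N); case: (m i4 == 0%N); rewrite ?(andbT, andbF) ?addr0 //.
Qed.

Lemma nf_tail_mcoeff (R : realType) (p : {mpoly R[4]}) :
  exists F : nf_coefs R,
    forall m, m != 0%MM -> nf_tail F m = p@_m.
Proof.
pose c r a (v : r.-tuple 'I_4) : series r R := fun u => p@_(a + mnm_at v u)%MM.
(* Each series is read off [p] on its own tail block; for [c1_1] and [c3_1] these are the blocks led
   by x2 and x4. *)
exists (NfCoefs (c _ (U_(i1) + U_(i2))%MM [tuple i1; i2; i3; i4])
          (c _ (U_(i1) + U_(i4))%MM [tuple i1; i3; i4])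
          (c _ (U_(i2) + U_(i3))%MM [tuple i2; i3; i4])
          (c _ (U_(i3) + U_(i4))%MM [tuple i3; i4])
          (c _ U_(i1)%MM [tuple i1; i3]) (c _ U_(i2)%MM [tuple i2; i4])
          (c _ U_(i3)%MM [tuple i3]) (c _ U_(i4)%MM [tuple i4])) => m m0.
rewrite /nf_tail /=.
have addE (f g : series 4 R) : (f + g) m = f m + g m by [].
rewrite !addE !block_mcoeffE //.
rewrite !in_blockE // !forall_ord4 !inE !mnmE -!val_eqE /=.
have : ~~ [&& m i1 == 0, m i2 == 0, m i3 == 0 & m i4 == 0]%N.
  apply: contra m0 => m0; apply/eqP/mnmP => i; rewrite mnmE; apply/eqP.
  by move: i; apply/forallP; rewrite forall_ord4.
rewrite !(addn0, add0n, subn0, leq0n, andbT).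
(* Each of the fifteen patterns of zero and positive exponents other than all zero selects exactly
   one block. *)
case: (m i1) (m i2) (m i3) (m i4) => [|?] [|?] [|?] [|?] //= _;
  by rewrite ?(addr0, add0r).
Qed.

Lemma lker_N22_form (R : realType) (k : nat) (phi : homog_vfield 4 R k) :
  phi \in lker (linfun (nabla (N22 R)^T (k := k))) <->
  exists F G : nf_coefs R,
    phi = vfield_part k (N22_form F G - linear_vfield (N22 R)).
Proof.
have headE (F : nf_coefs R) :
    series_homog_part k.+1 (nf_head F) =
    comp_linear (N22 R)^T (series_homog_part k.+1 (nf_tail F)).
  apply: dhomog_eqP => m md; rewrite mcoeff_comp_trN22 !mcoeff_homog_part md eqxx.
  rewrite nf_head_tail; case: ifP => // /andP[/eqP m2 /eqP m4].
  (* The push drops only the exponents of x2 and x4, which are zero here, so the degree is kept. *)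
  suff -> : mdeg (push_mnm m) = k.+1 by rewrite eqxx.
  by rewrite -md !mdegE !big_ord4 /= !mnmE /= m2 m4 !addn0.
rewrite lker_nabla_trN22; split=> [[e1 e3] | [F [G ->]]]; last first.
  by rewrite vfield_part_N22_form !ffunE /=.
have tailE (p : dhomog 4 R k.+1) :
    exists F : nf_coefs R, series_homog_part k.+1 (nf_tail F) = p.
  have [F FE] := nf_tail_mcoeff p; exists F.
  apply: dhomog_eqP => m md; rewrite mcoeff_homog_part md eqxx FE //.
  (* The monomial 1, which lies in no block, is excluded by the degree [k.+1]. *)
  by rewrite -mdeg_eq0 md.
have [F FE] := tailE (phi i2); have [G GE] := tailE (phi i4).
exists F, G; rewrite vfield_part_N22_form; apply: vfield4P.
by rewrite !ffunE /= !headE FE GE.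
Qed.

Theorem theorem6p5 (R : realType) (k : nat) (hk : (1 <= k)%N) :
  exists C : {vspace homog_vfield 4 R k},
    [/\ forall phi : homog_vfield 4 R k,
          phi \in C <->
          exists F G : nf_coefs R,
            phi = vfield_part k (N22_form F G - linear_vfield (N22 R)),
        (limg (linfun (nabla (N22 R) (k := k))) + C)%VS = fullv
      & directv (limg (linfun (nabla (N22 R) (k := k))) + C)].
Proof.
exists (lker (linfun (nabla (N22 R)^T (k := k)))); split.
- exact: lker_N22_form.
- exact: nabla_N22_sum.
- exact: nabla_N22_directv.
Qed.
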